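(* $m(5) \geq 29$; that is, every non-2-colorable $5$-uniform hypergraph has at least $29$ hyperedges.
   Context: A hypergraph $H=(V,E)$ consists of a finite vertex set $V$ and a set $E$ of subsets of $V$ (hyperedges); it is $n$-uniform if every hyperedge has exactly $n$ vertices. A 2-coloring of $H$ assigns one of two colors (red, blue) to each vertex; it is proper if no hyperedge is monochromatic. $H$ is non-2-colorable if it has no proper 2-coloring. For an integer $n \geq 1$, $m(n)$ denotes the minimum number of hyperedges in a non-2-colorable $n$-uniform hypergraph. *)

(* Defs.v *)
From mathcomp Require Import all_boot.
From mathcomp Require Import boolp.

Set Implicit Arguments.
Unset Strict Implicit.
Unset Printing Implicit Defensive.

Record hypergraph := Hypergraph {
  vertex : finType;
  edges : {set {set vertex}}
}.

Definition uniform (n : nat) (H : hypergraph) : bool :=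
  [forall e in edges H, #|e| == n].

(* The two colors, red and blue, are the two booleans. *)
Definition coloring (H : hypergraph) := {ffun vertex H -> bool}.

Definition monochromatic (H : hypergraph) (c : coloring H)
    (e : {set vertex H}) : bool :=
  [exists b : bool, [forall x in e, c x == b]].

Definition proper_coloring (H : hypergraph) (c : coloring H) : bool :=
  [forall e in edges H, ~~ monochromatic c e].

Definition two_colorable (H : hypergraph) : bool :=
  [exists c : coloring H, proper_coloring c].

(* The edge numbers of the n-uniform non-2-colorable hypergraphs.  The vertex
   type is unbounded, hence the classical reflection `[< _ >] into bool. *)
Definition non_2_colorable_size (n : nat) : pred nat := fun k =>
  `[< exists H : hypergraph,
        [/\ uniform n H, ~~ two_colorable H & #|edges H| = k] >].

(* By pigeonhole (and trivially when n = 0), the complete n-uniform hypergraph on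
   2n - 1 vertices is not 2-colorable. *)
Lemma non_2_colorable_size_exists (n : nat) :
  exists k, non_2_colorable_size n k.
Proof.
pose T : finType := 'I_(n.*2.-1).
pose H := @Hypergraph T [set e : {set T} | #|e| == n].
exists #|edges H|; apply/asboolP; exists H; split=> //.
  by apply/forall_inP => e; rewrite inE.
apply/existsP => -[c /forall_inP cP].
have [b leb] : exists b, n <= #|[set x : T | c x == b]|.
  have cardE : #|[set x : T | c x == true]| + #|[set x : T | c x == false]|
               = n.*2.-1.
    rewrite -[RHS](card_ord n.*2.-1) -(cardsC [set x : T | c x == true]).
    by congr (_ + _); apply: eq_card => x; rewrite !inE; case: (c x).
  case: (leqP n #|[set x : T | c x == true]|) => [?|lt1]; first by exists true.
  exists false; rewrite leqNgt; apply/negP => lt2.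
  have := leq_add lt1 lt2; rewrite addSn addnS cardE addnn.
  by case: (n) lt1 => // p _; rewrite doubleS /= ltnn.
have : 0 < #|[set e : {set T} | e \subset [set x | c x == b] & #|e| == n]|.
  by rewrite cards_draws bin_gt0.
case/card_gt0P => e; rewrite inE => /andP[/subsetP eb en].
have /negP := cP e (etrans (in_set _ _) en); apply.
apply/existsP; exists b; apply/forall_inP => x /eb.
by rewrite inE.
Qed.

Definition m (n : nat) : nat := ex_minn (non_2_colorable_size_exists n).

(* Main.v *)
Require Import Defs.
From mathcomp Require Import all_boot.
From mathcomp Require Import zify.

(** Identifying two vertices that lie in no common edge preserves uniformity and
    non-2-colorability, so one may assume that every pair of vertices is covered
    by an edge or that there are at most 22 vertices.  With 24 or more vertices,
    covering forces all degrees to be at least 6, hence at least 29 edges.  With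
    at most 22 vertices, pad to 22 and count monochromatic edges over all
    balanced colorings.

    The critical case is 23 vertices and 28 edges, where this first moment count
    is not enough.  For a coloring with 11 red vertices let X be the number of
    monochromatic edges.  The 132 bichromatic pairs need at least 22
    non-monochromatic edges, so 1 <= X <= 6 and X^2 + 6 <= 7 X.  Summed over all
    colorings this contradicts a lower bound on the second moment of X: two edges
    meeting in few vertices are jointly monochromatic often, and the sum of
    |e :&: f| over all (e, f) is the sum of the squared degrees, which is at most
    856 because the degrees are between 6 and 8 and add up to 140. *)

(** * Double counting of incidences *)

Lemma sum_card_rel (I J : finType) (A : {set I}) (B : {set J})
    (P : I -> J -> bool) :
  \sum_(i in A) #|[set j in B | P i j]| = \sum_(j in B) #|[set i in A | P i j]|.
Proof.
transitivity (\sum_(i in A) \sum_(j in B) P i j).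
  apply: eq_bigr => i _; rewrite -sum1_card.
  rewrite (eq_bigl (fun j => (j \in B) && P i j)) => [|j]; last by rewrite inE.
  by rewrite big_mkcondr; apply: eq_bigr => j _; case: (P i j).
rewrite exchange_big; apply: eq_bigr => j _; rewrite -sum1_card.
rewrite [RHS](eq_bigl (fun i => (i \in A) && P i j)) => [|i]; last by rewrite inE.
by rewrite big_mkcondr; apply: eq_bigr => i _; case: (P i j).
Qed.

Lemma card_setIdE (I : finType) (A : {set I}) (P : pred I) :
  #|[set i in A | P i]| = \sum_(i in A) P i.
Proof.
rewrite -sum1_card (eq_bigl (fun i => (i \in A) && P i)) => [|i]; last by rewrite inE.
by rewrite big_mkcondr; apply: eq_bigr => i _; case: (P i).
Qed.

(** * Colorings with a fixed number of red vertices, and degrees *)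

Section ColourClasses.
Variable T : finType.
Implicit Types (A B R e f : {set T}) (E : {set {set T}}).

(** A coloring is encoded by its set [R] of red vertices, so that [blocking] is non-2-colorability
    and [classes k] collects the colorings with [k] red vertices. *)
Definition mono_for R e := (e \subset R) || (e \subset ~: R).

Definition blocking E := forall R, exists2 e, e \in E & mono_for R e.

Definition pair_covering E :=
  forall x y, x != y -> exists2 e, e \in E & (x \in e) && (y \in e).

Definition degree E x := #|[set e in E | x \in e]|.

Definition classes k := [set R : {set T} | #|R| == k].

Definition nb_mono E R := #|[set e in E | mono_for R e]|.

Lemma card_classes k : #|classes k| = 'C(#|T|, k).
Proof. exact: card_draws. Qed.

(** Removing [A] from [R] leaves an arbitrary subset of size [k - #|A|] of the complement of
    [A :|: B]. *)
Lemma card_sets_between k A B : [disjoint A & B] -> #|A| <= k ->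
  #|[set R in classes k | (A \subset R) && (B \subset ~: R)]|
  = 'C(#|T| - (#|A| + #|B|), k - #|A|).
Proof.
move=> dAB leAk.
have cardAB : #|A :|: B| = #|A| + #|B|.
  by apply/eqP; rewrite (leq_card_setU A B).2.
have -> : #|T| - (#|A| + #|B|) = #|~: (A :|: B)|.
  by rewrite -cardAB -(cardsC (A :|: B)) addKn.
rewrite -cards_draws.
have disjC (S : {set T}) : S \subset ~: (A :|: B) -> [disjoint A & S].
  by rewrite setCU subsetI => /andP[SA _]; rewrite disjoint_sym disjoints_subset.
rewrite -[RHS](@card_in_imset _ _ (fun S => A :|: S)); last first.
  move=> S S'; rewrite !inE => /andP[SA _] /andP[SA' _] eqAS.
  have UK (U : {set T}) : [disjoint A & U] -> (A :|: U) :\: A = U.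
    move=> dU; rewrite setDUl setDv set0U; apply/setDidPl.
    by rewrite disjoint_sym.
  by rewrite -(UK _ (disjC _ SA)) eqAS UK ?disjC.
apply: eq_card => R; rewrite !inE; apply/idP/imsetP.
  case/and3P=> /eqP cR AR BR; exists (R :\: A); last first.
    by rewrite setDE setUIr setUCr setIT; apply/esym/setUidPr.
  rewrite inE cardsD (setIidPr AR) cR eqxx andbT setCU subsetI.
  rewrite subsetDr /= subDset; apply: (subset_trans _ (subsetUr _ _)).
  by rewrite -setCS setCK.
case=> S; rewrite inE => /andP[SAB /eqP cS] ->.
have dS := disjC _ SAB; apply/and3P; split.
- have /eqP -> : #|A :|: S| == #|A| + #|S| by rewrite (leq_card_setU A S).2.
  by rewrite cS subnKC.
- exact: subsetUl.
rewrite setCU subsetI; apply/andP; split.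
  by rewrite -disjoints_subset disjoint_sym.
by rewrite -setCS setCK (subset_trans SAB) // setCS subsetUr.
Qed.

Lemma mono_forE R e : e != set0 ->
  mono_for R e = (e \subset R) + (e \subset ~: R) :> nat.
Proof.
case/set0Pn=> x xe; rewrite /mono_for.
have [eR|//] := boolP (e \subset R); have [eR'|//] := boolP (e \subset ~: R).
by have := subsetP eR' _ xe; rewrite inE (subsetP eR).
Qed.

Lemma card_mono k e : e != set0 -> #|e| <= k ->
  #|[set R in classes k | mono_for R e]|
  = 'C(#|T| - #|e|, k - #|e|) + 'C(#|T| - #|e|, k).
Proof.
move=> e0 lek; rewrite card_setIdE.
under eq_bigr => R _ do rewrite mono_forE //.
rewrite big_split -!card_setIdE; congr (_ + _).
  have := card_sets_between k e set0; rewrite cards0 addn0 => <- //.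
    by apply: eq_card => R; rewrite !inE sub0set andbT.
  by rewrite disjoint_sym disjoints_subset sub0set.
have := card_sets_between k set0 e; rewrite cards0 subn0 => <- //.
  by apply: eq_card => R; rewrite !inE sub0set.
by rewrite disjoints_subset sub0set.
Qed.

(** Either both sets get the same color, so that their union is monochromatic, or they get opposite
    colors, which requires disjointness; these cases exclude each other. *)
Lemma card_mono_pair k e f : e != set0 -> f != set0 -> #|e :|: f| <= k ->
  'C(#|T| - #|e :|: f|, k - #|e :|: f|) + 'C(#|T| - #|e :|: f|, k)
  + (if [disjoint e & f] then
       'C(#|T| - (#|e| + #|f|), k - #|e|) + 'C(#|T| - (#|f| + #|e|), k - #|f|)
     else 0)
  <= #|[set R in classes k | mono_for R e && mono_for R f]|.
Proof.
move=> e0 f0 lek.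
have u0 : e :|: f != set0 by rewrite setU_eq0 negb_and e0.
rewrite -card_mono // !card_setIdE.
have [def|ndef] := boolP [disjoint e & f]; last first.
  rewrite addn0; apply: leq_sum => R _; rewrite /mono_for !subUset.
  by do 4!case: (_ \subset _).
rewrite -!card_sets_between ?(leq_trans _ lek) ?subset_leq_card ?subsetUl ?subsetUr //;
  last by rewrite disjoint_sym.
rewrite !card_setIdE -!big_split; apply: leq_sum => R _.
rewrite /= -[X in _ <= X]mulnb !mono_forE // !subUset.
by do 4!case: (_ \subset _).
Qed.

Lemma sum_degree E : \sum_x degree E x = \sum_(e in E) #|e|.
Proof.
rewrite /degree -(eq_bigl _ _ (in_setT (T:=T))) sum_card_rel; apply: eq_bigr => e _.
by apply: eq_card => x; rewrite !inE.
Qed.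

Lemma sum_degree_sqr E :
  \sum_x degree E x ^ 2 = \sum_(p in setX E E) #|p.1 :&: p.2|.
Proof.
transitivity (\sum_(x in [set: T])
    #|[set p in setX E E | (x \in p.1) && (x \in p.2)]|).
  rewrite (eq_bigl _ _ (in_setT (T:=T))); apply: eq_bigr => x _.
  rewrite -mulnn -cardsX; apply: eq_card => -[e f].
  by rewrite !inE /= andbACA.
rewrite sum_card_rel; apply: eq_bigr => -[e f] _.
by apply: eq_card => x; rewrite !inE.
Qed.

Lemma sum_nb_mono E k : \sum_(R in classes k) nb_mono E R
  = \sum_(e in E) #|[set R in classes k | mono_for R e]|.
Proof. exact: sum_card_rel. Qed.

Lemma sum_nb_mono_sqr E k : \sum_(R in classes k) nb_mono E R ^ 2
  = \sum_(p in setX E E)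
      #|[set R in classes k | mono_for R p.1 && mono_for R p.2]|.
Proof.
rewrite -sum_card_rel; apply: eq_bigr => R _.
rewrite -mulnn -cardsX; apply: eq_card => -[e f].
by rewrite !inE /= andbACA.
Qed.

Lemma nb_mono_gt0 E R : blocking E -> 0 < nb_mono E R.
Proof. by case/(_ R)=> e eE eR; apply/card_gt0P; exists e; rewrite inE eE. Qed.

(** The edges through [x] must reach all other vertices, and each reaches only [r] of them. *)
Lemma pair_covering_degree E r x : pair_covering E ->
  {in E, forall e, #|e| = r.+1} -> #|T|.-1 <= r * degree E x.
Proof.
move=> covE cardE.
have -> : #|T|.-1 = \sum_(y in [set~ x]) 1 by rewrite sum1_card cardsC1.
have -> : r * degree E x =
    \sum_(e in [set e in E | x \in e]) #|[set y in [set~ x] | y \in e]|.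
  rewrite mulnC -sum_nat_const; apply: eq_bigr => e; rewrite inE => /andP[eE xe].
  have := cardE e eE; rewrite (cardsD1 x) xe => -[<-].
  by apply: eq_card => y; rewrite !inE.
rewrite -sum_card_rel; apply: leq_sum => y; rewrite !inE => yx.
have [e eE /andP[ye xe]] := covE y x yx.
by apply/card_gt0P; exists e; rewrite !inE eE xe.
Qed.

End ColourClasses.

(** * Binomial coefficients in factored form, from recurrences *)

Lemma bin17_6 : 'C(17, 6) = 7 * 8 * 13 * 17.
Proof.
have := bin1 17; have := mul_bin_left 17 1; have := mul_bin_left 17 2.
by have := mul_bin_left 17 3; have := mul_bin_left 17 4;
   have := mul_bin_left 17 5; lia.
Qed.

Lemma bin22_11 : 'C(22, 11) = 57 * 'C(17, 6).
Proof.
have := mul_bin_diag 22 10; have := mul_bin_diag 21 9; have := mul_bin_diag 20 8.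
have := mul_bin_diag 19 7; have := mul_bin_diag 18 6; have := mul_bin_left 17 6.
by have := bin17_6; rewrite /=; lia.
Qed.

Lemma bin18_6 : 'C(18, 6) = 12 * (7 * 13 * 17).
Proof.
by have := mul_bin_diag 18 5; have := mul_bin_left 17 5; have := bin17_6;
   rewrite /=; lia.
Qed.

Lemma bin18_11 : 'C(18, 11) = 144 * (13 * 17).
Proof.
rewrite (bin_sub (isT : 7 <= 18) : 'C(18, 11) = 'C(18, 7)).
by have := mul_bin_left 18 6; have := bin18_6; lia.
Qed.

Lemma bin23_11 : 'C(23, 11) = 322 * (13 * 17 * 19).
Proof.
have := mul_bin_left 22 10; have := mul_bin_diag 23 10.
by have := bin22_11; have := bin17_6; rewrite /=; lia.
Qed.

(** * The cases of 22 and 23 vertices *)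

Section FiveUniform.
Variables (T : finType) (E : {set {set T}}).
Hypotheses (unifE : {in E, forall e : {set T}, #|e| = 5}) (blockE : blocking T E).

Lemma edge_neq0 e : e \in E -> e != set0.
Proof. by move=> eE; rewrite -card_gt0 unifE. Qed.

Lemma sum_nb_mono_uniform k : 5 <= k ->
  \sum_(R in classes T k) nb_mono T E R
  = #|E| * ('C(#|T| - 5, k - 5) + 'C(#|T| - 5, k)).
Proof.
move=> k5; rewrite sum_nb_mono -sum_nat_const; apply: eq_bigr => e eE.
by rewrite card_mono ?edge_neq0 ?unifE.
Qed.

(** Each edge is monochromatic in 2 * C(17, 6) of the 57 * C(17, 6) balanced colorings, and every
    coloring needs such an edge, so 2 * #|E| >= 57. *)
Lemma order22_bound : #|T| = 22 -> 28 < #|E|.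
Proof.
move=> cT; have := sum_nb_mono_uniform 11 isT; rewrite cT => sumE.
have : 'C(22, 11) <= \sum_(R in classes T 11) nb_mono T E R.
  rewrite -[22]cT -card_classes -sum1_card; apply: leq_sum => R _.
  exact: nb_mono_gt0.
rewrite sumE (_ : 22 - 5 = 17); last by [].
rewrite (_ : 11 - 5 = 6); last by [].
have -> : 'C(17, 11) = 'C(17, 6) := bin_sub (isT : 6 <= 17).
by rewrite bin22_11 bin17_6; lia.
Qed.

Hypotheses (covE : pair_covering T E) (cT : #|T| = 23) (cE : #|E| <= 28).

Lemma order23_degree_ge x : 6 <= degree T E x.
Proof. by have := pair_covering_degree T E 4 x covE unifE; rewrite cT; lia. Qed.

Lemma order23_sum_degree : \sum_x degree T E x = 5 * #|E|.
Proof.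
by rewrite sum_degree mulnC -sum_nat_const; apply: eq_bigr => e /unifE.
Qed.

(** The degree sum 5 * #|E| is at least 23 * 6 = 138, which excludes 27 edges. *)
Lemma order23_size : #|E| = 28.
Proof.
have : 23 * 6 <= \sum_x degree T E x.
  rewrite -cT -[#|T|]cardsT -sum_nat_const (eq_bigl _ _ (in_setT (T:=T))).
  by apply: leq_sum => x _; exact: order23_degree_ge.
by rewrite order23_sum_degree; lia.
Qed.

(** The other 22 vertices use at least 132 of the degree sum 140. *)
Lemma order23_degree_le x : degree T E x <= 8.
Proof.
have := order23_sum_degree; rewrite order23_size (bigD1 x) //=.
suff : 22 * 6 <= \sum_(y | y != x) degree T E y by lia.
have -> : 22 * 6 = \sum_(y | y != x) 6.
  by rewrite sum_nat_const cardC1 cT.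
by apply: leq_sum => y _; exact: order23_degree_ge.
Qed.

(** Sum (d - 6)(d - 8) <= 0 over all vertices: 14 * 140 - 48 * 23 = 856. *)
Lemma order23_sum_degree_sqr : \sum_x degree T E x ^ 2 <= 856.
Proof.
have : \sum_x (degree T E x ^ 2 + 48) <= \sum_x 14 * degree T E x.
  apply: leq_sum => x _.
  by have := order23_degree_ge x; have := order23_degree_le x; nia.
rewrite big_split sum_nat_const -big_distrr order23_sum_degree order23_size cT /=.
by lia.
Qed.

(* Each of the 11 * 12 bichromatic pairs lies in a non-monochromatic edge, and
   such an edge contains at most 2 * 3 of them. *)
Lemma order23_nb_mono_le R : R \in classes T 11 -> nb_mono T E R <= 6.
Proof.
rewrite inE => /eqP cR.
have cCR : #|~: R| = 12 by have := cardsC R; rewrite cR cT; lia.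
have : 11 * 12 <= \sum_(p in setX R (~: R))
    #|[set e in E | (p.1 \in e) && (p.2 \in e)]|.
  rewrite -{1}cR -cCR -cardsX -sum1_card; apply: leq_sum => -[x y].
  rewrite !inE /= => /andP[xR yR].
  have [|e eE xye] := covE x y; first by apply: contraNneq yR => <-.
  by apply/card_gt0P; exists e; rewrite !inE eE.
rewrite sum_card_rel => le132.
have : 11 * 12 <= \sum_(e in E) 6 * ~~ mono_for T R e.
  apply: leq_trans le132 _; apply: leq_sum => e eE.
  have -> : [set p in setX R (~: R) | (p.1 \in e) && (p.2 \in e)]
      = setX (R :&: e) (~: R :&: e).
    by apply/setP => -[x y]; rewrite !inE /= andbACA.
  rewrite cardsX; have := cardsID R e; rewrite (unifE e eE) setDE ![_ :&: e]setIC.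
  have [/orP[eR|eR]|_] := boolP (mono_for T R e).
  - have -> : e :&: ~: R = set0 by apply/eqP; rewrite -setDE setD_eq0.
    by rewrite cards0 muln0.
  - have -> : e :&: R = set0 by apply/eqP; rewrite setI_eq0 disjoints_subset.
    by rewrite cards0 mul0n.
  move: #|_| #|_| => a b; case: a => [|[|[|[|[|[|a]]]]]]; lia.
rewrite -big_distrr -card_setIdE /nb_mono.
suff : #|[set e in E | mono_for T R e]| + #|[set e in E | ~~ mono_for T R e]|
    = 28 by rewrite /=; lia.
rewrite -order23_size -(cardsID [set e | mono_for T R e] E).
by congr (_ + _); apply: eq_card => e; rewrite !inE // andbC.
Qed.

(* Distinct edges are jointly monochromatic for 3523 = 13 * 271 colorings when
   disjoint and for 455 = 3523 - 3068 when they share one vertex; 3068 = 13 * 236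
   is the slope through these values.  For e = f there are 50388 colorings, and
   13 * (55 * 87) = 50388 + 5 * 3068 - 3523.  The products keep [nat] literals
   small. *)
Lemma order23_mono_pair e f : e \in E -> f \in E ->
  13 * 271 + (e == f) * (13 * (55 * 87))
  <= #|[set R in classes T 11 | mono_for T R e && mono_for T R f]|
     + 13 * 236 * #|e :&: f|.
Proof.
move=> eE fE; have e0 := edge_neq0 e eE; have f0 := edge_neq0 f fE.
have [<-|nef] := eqVneq e f.
  have -> : [set R in classes T 11 | mono_for T R e && mono_for T R e]
      = [set R in classes T 11 | mono_for T R e].
    by apply/setP => R; rewrite !inE andbb.
  rewrite setIid card_mono ?unifE // cT.
  rewrite (_ : 23 - 5 = 18); last by [].
  rewrite (_ : 11 - 5 = 6); last by [].
  by rewrite bin18_6 bin18_11; lia.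
rewrite mul0n addn0.
have cU := cardsUI e f; rewrite (unifE e eE) (unifE f fE) in cU.
(* With two common vertices the right side suffices by itself, as 2 * 236 >= 271. *)
have [I2|I2] := leqP 2 #|e :&: f|; first by nia.
have leU : #|e :|: f| <= 11 by lia.
have := card_mono_pair T 11 e f e0 f0 leU.
rewrite cT (unifE e eE) (unifE f fE) -setI_eq0 -cards_eq0.
(* Disjoint edges: C(13, 1) + C(13, 11) + 2 * C(13, 6) = 3523. One common vertex: C(14, 2) + C(14,
   11) = 455. Both are checked by computation. *)
case: #|e :&: f| I2 cU => [|[|//]] _ cU /=.
  rewrite (_ : #|e :|: f| = 10); last by lia.
  by rewrite muln0 addn0; apply: leq_trans.
rewrite (_ : #|e :|: f| = 9); last by lia.
by move=> le_c; apply: leq_trans (leq_add le_c (leqnn _)).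
Qed.

(** For S the sum of the squares of [nb_mono], [S2] gives S >= 1877564, while [S0] and [S1] give S
    <= 7 * 28 * 50388 - 6 * C(23, 11) = 1763580. *)
Lemma order23_false : False.
Proof.
have S2 : #|E| ^ 2 * (13 * 271) + #|E| * (13 * (55 * 87))
    <= \sum_(R in classes T 11) nb_mono T E R ^ 2 + 13 * 236 * 856.
  apply: (@leq_trans (\sum_(R in classes T 11) nb_mono T E R ^ 2 +
      13 * 236 * \sum_(p in setX E E) #|p.1 :&: p.2|)); last first.
    by rewrite leq_add2l leq_mul2l -sum_degree_sqr order23_sum_degree_sqr orbT.
  rewrite sum_nb_mono_sqr big_distrr -big_split /=.
  have -> : #|E| ^ 2 * (13 * 271) + #|E| * (13 * (55 * 87)) =
      \sum_(p in setX E E) (13 * 271 + (p.1 == p.2) * (13 * (55 * 87))).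
    rewrite big_split sum_nat_const cardsX mulnn -big_distrl /=; congr (_ + _ * _).
    rewrite -card_setIdE -[LHS](card_imset _ (f := fun e => (e, e))) => [|e f []//].
    apply: eq_card => -[e f]; rewrite !inE /=.
    apply/imsetP/idP => [[g gE [-> ->]]|/andP[/andP[eE _] /eqP <-]].
      by rewrite gE eqxx.
    by exists e.
  apply: leq_sum => -[e f]; rewrite inE => /andP[eE fE].
  exact: order23_mono_pair.
have S1 := sum_nb_mono_uniform 11 isT.
have S0 : \sum_(R in classes T 11) (nb_mono T E R ^ 2 + 6)
    <= \sum_(R in classes T 11) 7 * nb_mono T E R.
  apply: leq_sum => R Rk; have := order23_nb_mono_le R Rk.
  by have := nb_mono_gt0 T E R blockE; nia.
move: S0; rewrite big_split -big_distrr S1 sum_nat_const card_classes /=.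
move: S2; rewrite order23_size cT.
rewrite (_ : 23 - 5 = 18); last by [].
rewrite (_ : 11 - 5 = 6); last by [].
rewrite bin18_6 bin18_11 bin23_11.
by rewrite -[28 ^ 2]mulnn; move: (\sum_(R in _) _ ^ 2) => S; lia.
Qed.

End FiveUniform.

(** * Maps between vertex sets and the reduction to few vertices *)

(** The image of [e] is monochromatic for [R] exactly when [e] is so for the preimage of [R]. *)
Lemma blocking_imset (T T' : finType) (f : T -> T') (E : {set {set T}}) :
  blocking T E -> blocking T' [set f @: (e : {set T}) | e in E].
Proof.
move=> blockE R; have [e eE eR] := blockE (f @^-1: R).
exists (f @: e); first exact: imset_f.
by rewrite /mono_for !sub_imset_pre preimsetC.
Qed.

(** Distinct edges may acquire the same image, but this only lowers the edge count, so a lower bound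
    for the image carries back. *)
Lemma blocking_pull (T T' : finType) (f : T -> T') (E : {set {set T}}) r k :
    {in E, forall e : {set T}, {in e &, injective f}} ->
    {in E, forall e : {set T}, #|e| = r} -> blocking T E ->
    (forall E' : {set {set T'}}, {in E', forall e : {set T'}, #|e| = r} ->
       blocking T' E' -> k < #|E'|) ->
  k < #|E|.
Proof.
move=> injf unifE blockE boundE'.
apply: leq_trans (leq_imset_card (fun e : {set T} => f @: e) E).
apply: boundE'; last exact: blocking_imset.
move=> _ /imsetP[e eE ->]; rewrite card_in_imset ?unifE //; exact: injf.
Qed.

(** Since 4 * degree >= 23, all degrees are at least 6, and 5 * #|E| >= 24 * 6 = 144. *)
Lemma pair_covering_size (T : finType) (E : {set {set T}}) :
    {in E, forall e : {set T}, #|e| = 5} -> pair_covering T E -> 24 <= #|T| ->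
  28 < #|E|.
Proof.
move=> unifE covE cT.
have : #|T| * 6 <= \sum_x degree T E x.
  rewrite -[#|T|]cardsT -sum_nat_const (eq_bigl _ _ (in_setT (T:=T))).
  apply: leq_sum => x _.
  by have := pair_covering_degree T E 4 x covE unifE; lia.
rewrite sum_degree (eq_bigr (fun=> 5)) => [|e /unifE //].
by rewrite sum_nat_const; lia.
Qed.

Lemma pair_coveringPn (T : finType) (E : {set {set T}}) :
  pair_covering T E \/
  exists x y, x != y /\ {in E, forall e : {set T}, ~~ ((x \in e) && (y \in e))}.
Proof.
have [|] := boolP [forall x, forall y, (x != y) ==>
    [exists e in E, (x \in e) && (y \in e)]].
  move=> /forallP cov; left => x y xy.
  have /forallP/(_ y)/implyP/(_ xy)/exists_inP[e eE xye] := cov x.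
  by exists e.
rewrite negb_forall => /existsP[x]; rewrite negb_forall => /existsP[y].
rewrite negb_imply => /andP[xy]; rewrite negb_exists_in => /forall_inP ncov.
by right; exists x, y.
Qed.

Lemma blocking_five_uniform_size (T : finType) (E : {set {set T}}) :
  {in E, forall e : {set T}, #|e| = 5} -> blocking T E -> 28 < #|E|.
Proof.
have [n] := ubnP #|T|; elim: n T E => // n IHn T E ltTn unifE blockE.
have [le22|gt22] := leqP #|T| 22.
  (* Padding: embed the vertices into ['I_22]. *)
  apply: (blocking_pull T _ (fun x => widen_ord le22 (enum_rank x)) E 5) => //.
    move=> e _ x y _ _ /(congr1 val) /= /val_inj; exact: enum_rank_inj.
  by move=> E' unifE' blockE'; apply: order22_bound; rewrite ?card_ord.
have [covE|[x [y [xy ncov]]]] := pair_coveringPn T E.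
  have [le24|lt24] := leqP 24 #|T|; first exact: pair_covering_size.
  have [//|le28] := ltnP 28 #|E|; exfalso.
  have cT : #|T| = 23 by lia.
  exact: (order23_false T E unifE blockE covE cT le28).
have yx : y != x by rewrite eq_sym.
(* [f] merges [x] into [y]: the default value of [insubd] is taken only at [x]. It is injective on
   each edge because no edge contains both. *)
pose f z := insubd (exist (fun z => z != x) y yx) z : {z | z != x}.
have fE z : val (f z) = if z == x then y else z by rewrite val_insubd; case: eqP.
apply: (blocking_pull T _ f E 5) => // [e eE u v ue ve /(congr1 val)|E'].
  rewrite !fE; move: ue ve (ncov e eE).
  have [->|_] := eqVneq u x; have [->|_] := eqVneq v x => // ue ve.
  - by rewrite ue => ye eq_yv; rewrite eq_yv ve in ye.
  - by rewrite ve => ye eq_uy; rewrite -eq_uy ue in ye.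
by apply: IHn; rewrite card_sig (cardC1 x : #|[pred z | z != x]| = _); lia.
Qed.

Theorem mainTheorem4 :
  29 <= m 5 /\
  (forall H : hypergraph,
     uniform 5 H -> ~~ two_colorable H -> 29 <= #|edges H|).
Proof.
have bound (H : hypergraph) :
    uniform 5 H -> ~~ two_colorable H -> 29 <= #|edges H|.
  move=> /forall_inP unifH; rewrite negb_exists => /forallP ncol.
  apply: blocking_five_uniform_size => [e eE|R]; first exact/eqP/unifH.
  have := ncol [ffun x => x \in R].
  rewrite negb_forall_in => /exists_inP[e eE]; rewrite negbK => /existsP[b eb].
  exists e => //; apply/orP; case: b eb => /forall_inP eb; [left|right];
    by apply/subsetP => x /eb; rewrite ?inE ffunE => /eqP->.
split=> //; rewrite /m; case: ex_minnP => k /boolp.asboolP[H [uH cH <-]] _.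
exact: bound.
Qed.
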